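(* Let $c$ be admissible and write $c^2=\frac{n_*}{p_*}$ with coprime $n_*,p_*\in\mathbb{N}$. Let $(m_0,r_0)$ be the minimal solution in natural numbers of the Pell equation $m^2-dr^2=1$, where $d=c^2p_*^2$. Then $$m_1=m_0,\qquad n_1=r_0n_*,\qquad p_1=r_0p_*$$ is the minimal triple $(m_1,n_1,p_1)$ of $c$, and this triple corresponds to the minimal term $V_1=\frac{n_1}{m_1}$ of the positive part of the spectrum of $c$.
   Context: Let $\mathbb{N}=\{1,2,\dots\}$. A pair of real numbers $(V,c)$ with $0<|V|<c$ is called admissible if the linear map of $\mathbb{R}^2$ $(x,t)\mapsto\left(\frac{x-Vt}{\sqrt{1-V^2/c^2}},\frac{t-\frac{V}{c^2}x}{\sqrt{1-V^2/c^2}}\right)$ is the lift of a homeomorphism of $T^2=\mathbb{R}^2/\mathbb{Z}^2$. A number $c>0$ is admissible if $(V,c)$ is admissible for some $V$; the spectrum of $c$ is the set of all $V$ with $(V,c)$ admissible. The positive part of the spectrum is listed in increasing order as $V_1<V_2<\cdots$. Each admissible pair $(V,c)$ with $V>0$ corresponds to a unique triple $(m,n,p)$ with $m^2-np=1$, $m\ge2$, $n,p\in\mathbb{N}$, via $c=\sqrt{n/p}$, $V=n/m$, and conversely every such triple gives an admissible pair. The triples of $c$ are those with $\sqrt{n/p}=c$. Triples are partially ordered by $(m,n,p)<(m',n',p')$ iff $m<m'$, $n<n'$, $p<p'$; the minimal triple of $c$ is the smallest triple of $c$ in this order. The minimal solution of a Pell equation is its smallest solution in positive integers. *)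

(* Defs.v *)
From mathcomp Require Import all_boot all_order all_algebra generic_quotient.
From mathcomp Require Import all_classical all_reals all_analysis.

Set Implicit Arguments.
Unset Strict Implicit.
Unset Printing Implicit Defensive.

Import Order.TTheory GRing.Theory Num.Theory.
Import numFieldNormedType.Exports.

Local Open Scope classical_set_scope.
Local Open Scope ring_scope.
Local Open Scope quotient_scope.

Definition lattice_rel (R : realType) : rel (R * R) :=
  fun z w => (z.1 - w.1 \is a Num.int) && (z.2 - w.2 \is a Num.int).

Lemma lattice_rel_refl (R : realType) : reflexive (@lattice_rel R).
Proof. by move=> z; rewrite /lattice_rel !subrr !rpred0. Qed.

Lemma lattice_rel_sym (R : realType) : symmetric (@lattice_rel R).
Proof.
by move=> z w; rewrite /lattice_rel -(opprB w.1) -(opprB w.2) !rpredN.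
Qed.

Lemma lattice_rel_trans (R : realType) : transitive (@lattice_rel R).
Proof.
move=> w z u /andP[zw1 zw2] /andP[wu1 wu2]; apply/andP; split.
  by rewrite -(subrKA w.1) rpredD.
by rewrite -(subrKA w.2) rpredD.
Qed.

Definition lattice_equiv (R : realType) : equiv_rel (R * R)%type :=
  EquivRel (@lattice_rel R) (@lattice_rel_refl R) (@lattice_rel_sym R)
    (@lattice_rel_trans R).

Definition torus (R : realType) := quotient_topology {eq_quot (lattice_equiv R)}.


Definition homeomorphism (X Y : topologicalType) (f : X -> Y) : Prop :=
  continuous f /\
  exists g : Y -> X, [/\ continuous g, cancel f g & cancel g f].

(* [F] lifts [f] along the projection of the plane onto the torus. *)
Definition is_lift (R : realType) (F : R * R -> R * R)
    (f : torus R -> torus R) : Prop :=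
  forall z, \pi_(torus R) (F z) = f (\pi_(torus R) z).

Definition lorentz (R : realType) (V c : R) (z : R * R) : R * R :=
  ((z.1 - V * z.2) / Num.sqrt (1 - V ^+ 2 / c ^+ 2),
   (z.2 - V / c ^+ 2 * z.1) / Num.sqrt (1 - V ^+ 2 / c ^+ 2)).

Definition admissible_pair (R : realType) (V c : R) : Prop :=
  0 < `|V| < c /\
  exists f : torus R -> torus R, homeomorphism f /\ is_lift (lorentz V c) f.

Definition admissible (R : realType) (c : R) : Prop :=
  0 < c /\ exists V : R, admissible_pair V c.

Definition spectrum (R : realType) (c : R) : set R :=
  [set V | admissible_pair V c].

Definition positive_spectrum (R : realType) (c : R) : set R :=
  [set V | spectrum c V /\ 0 < V].

Definition is_minimum (R : realType) (A : set R) (x : R) : Prop :=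
  A x /\ lbound A x.

Definition is_triple (t : nat * nat * nat) : Prop :=
  let: (m, n, p) := t in
  [/\ (2 <= m)%N, (1 <= n)%N, (1 <= p)%N
    & m%:Z ^+ 2 - n%:Z * p%:Z = 1].

Definition triple_of (R : realType) (c : R) (t : nat * nat * nat) : Prop :=
  let: (_, n, p) := t in is_triple t /\ Num.sqrt (n%:R / p%:R) = c.

Definition corresponds (R : realType) (V c : R) (t : nat * nat * nat) : Prop :=
  let: (m, n, p) := t in
  [/\ is_triple t, c = Num.sqrt (n%:R / p%:R) & V = n%:R / m%:R].

Definition triple_lt (t t' : nat * nat * nat) : Prop :=
  let: (m, n, p) := t in let: (m', n', p') := t' in
  [/\ (m < m')%N, (n < n')%N & (p < p')%N].

(* Least, not merely minimal: [t] is below every other triple of [c]. *)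
Definition minimal_triple (R : realType) (c : R) (t : nat * nat * nat) : Prop :=
  triple_of c t /\ forall t', triple_of c t' -> t' <> t -> triple_lt t t'.

Definition pell_solution (d m r : nat) : Prop :=
  [/\ (1 <= m)%N, (1 <= r)%N & m%:Z ^+ 2 - d%:Z * r%:Z ^+ 2 = 1].

Definition minimal_pell_solution (d m r : nat) : Prop :=
  pell_solution d m r /\
  forall m' r', pell_solution d m' r' -> (m <= m')%N /\ (r <= r')%N.

(* Main.v *)
Require Import Defs.
From mathcomp Require Import all_boot all_order all_algebra generic_quotient.
From mathcomp Require Import all_classical all_reals all_analysis.
From mathcomp Require Import zify ring.

Set Implicit Arguments.
Unset Strict Implicit.
Unset Printing Implicit Defensive.

Import Order.TTheory GRing.Theory Num.Theory.
Import numFieldNormedType.Exports.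
Local Open Scope ring_scope.

(** Put s = sqrt (1 - V^2/c^2).  The Lorentz map has the matrix with rows
    (1/s, -V/s) and (-V/(c^2 s), 1/s), of determinant 1.  A linear map of the
    plane descends to the torus only if it sends the lattice Z^2 into itself,
    that is, only if its matrix is integral ([lift_plane_map_int]); conversely
    an integral matrix of determinant 1 descends, and so does its inverse,
    which makes the induced map a homeomorphism ([torus_map_homeomorphism]).
    Hence the pairs (V, c) with V > 0 that are admissible are those for which
    1/s = m, V/s = n and V/(c^2 s) = p are positive integers.  These satisfy
    m^2 - n p = 1, c^2 = n/p and V = n/m ([triple_admissible],
    [admissible_triple]).

    If c^2 = ns/ps in lowest terms, then n/p = ns/ps forces (n, p) =
    (k ns, k ps), and m^2 - n p = 1 becomes the Pell equation
    m^2 - ns ps k^2 = 1, where ns ps = c^2 ps^2 is the given d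
    ([triple_of_pell]).  The triples of c are therefore ordered like the
    solutions (m, k), and the least solution yields the least triple.
    Finally V^2 = c^2 (1 - 1/m^2) shows that V grows with m for fixed c
    ([corresponds_le]), so the least triple gives the least velocity. *)

(** * Linear maps of the torus *)

Lemma torus_piP (R : realType) (z w : R * R) :
  reflect (\pi_(torus R) z = \pi_(torus R) w)%qT (lattice_rel z w).
Proof. exact: (@eqmodP _ (lattice_equiv R)). Qed.

(** The linear map with matrix rows (a, b) and (c, d). *)
Definition plane_map (R : realType) (a b c d : R) (z : R * R) : R * R :=
  (a * z.1 + b * z.2, c * z.1 + d * z.2).

Lemma plane_map_continuous (R : realType) (a b c d : R) :
  continuous (plane_map a b c d).
Proof.
have affine u v : continuous (fun z : R * R => u * z.1 + v * z.2).
  by move=> z; apply: cvgD; apply: cvgM;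
    [exact: cvg_cst|exact: cvg_fst|exact: cvg_cst|exact: cvg_snd].
by move=> z; apply: (cvg_pair (affine a b z) (affine c d z)).
Qed.

(** For determinant 1 the inverse matrix is the adjugate. *)
Lemma plane_map_cancel (R : realType) (a b c d : R) :
  a * d - b * c = 1 -> cancel (plane_map a b c d) (plane_map d (- b) (- c) a).
Proof.
move=> det1 [x y]; rewrite /plane_map /=; congr pair.
  by rewrite -[RHS]mul1r -det1; ring.
by rewrite -[RHS]mul1r -det1; ring.
Qed.

Lemma lattice_rel_plane_map (R : realType) (a b c d : R) (z w : R * R) :
  a \is a Num.int -> b \is a Num.int -> c \is a Num.int -> d \is a Num.int ->
  lattice_rel z w -> lattice_rel (plane_map a b c d z) (plane_map a b c d w).
Proof.
move=> ia ib ic id /andP[zw1 zw2]; apply/andP; split => /=.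
  have -> : a * z.1 + b * z.2 - (a * w.1 + b * w.2)
          = a * (z.1 - w.1) + b * (z.2 - w.2) by ring.
  by rewrite rpredD ?rpredM.
have -> : c * z.1 + d * z.2 - (c * w.1 + d * w.2)
        = c * (z.1 - w.1) + d * (z.2 - w.2) by ring.
by rewrite rpredD ?rpredM.
Qed.

(** Defined through an arbitrary representative, so that it makes sense for
    every matrix; it is induced by the plane map only for integral ones. *)
Definition torus_map (R : realType) (a b c d : R) : torus R -> torus R :=
  fun x => \pi_(torus R)%qT (plane_map a b c d (repr x)).

Lemma torus_map_lift (R : realType) (a b c d : R) :
  a \is a Num.int -> b \is a Num.int -> c \is a Num.int -> d \is a Num.int ->
  is_lift (plane_map a b c d) (@torus_map R a b c d).
Proof.
move=> ia ib ic id z; apply/torus_piP; apply: lattice_rel_plane_map => //.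
by apply/torus_piP; rewrite reprK.
Qed.

Lemma torus_map_continuous (R : realType) (a b c d : R) :
  a \is a Num.int -> b \is a Num.int -> c \is a Num.int -> d \is a Num.int ->
  continuous (@torus_map R a b c d).
Proof.
move=> ia ib ic id; apply/quotient_continuous.
have -> : (@torus_map R a b c d \o \pi_(torus R)%qT
           = \pi_(torus R)%qT \o plane_map a b c d)%FUN.
  by apply/funext => z /=; rewrite torus_map_lift.
move=> z; apply: continuous_comp; first exact: plane_map_continuous.
exact: pi_continuous.
Qed.

Lemma torus_map_cancel (R : realType) (a b c d : R) :
  a \is a Num.int -> b \is a Num.int -> c \is a Num.int -> d \is a Num.int ->
  a * d - b * c = 1 ->
  cancel (@torus_map R a b c d) (@torus_map R d (- b) (- c) a).
Proof.
move=> ia ib ic id det1 x.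
rewrite [torus_map a b c d x]/torus_map -torus_map_lift ?rpredN//.
by rewrite plane_map_cancel ?reprK.
Qed.

(** The adjugate matrix is again integral of determinant 1, so it induces the
    inverse map, which is continuous for the same reason. *)
Lemma torus_map_homeomorphism (R : realType) (a b c d : R) :
  a \is a Num.int -> b \is a Num.int -> c \is a Num.int -> d \is a Num.int ->
  a * d - b * c = 1 -> homeomorphism (@torus_map R a b c d).
Proof.
move=> ia ib ic id det1; split; first exact: torus_map_continuous.
exists (@torus_map R d (- b) (- c) a); split.
- by apply: torus_map_continuous; rewrite ?rpredN.
- exact: torus_map_cancel.
- rewrite -{2}(opprK b) -{2}(opprK c); apply: torus_map_cancel;
    rewrite ?rpredN//.
  by rewrite -det1; ring.
Qed.

(** The basis vectors (1, 0) and (0, 1) are equivalent to the origin, so their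
    images, the columns of the matrix, are equivalent to the image 0 of the
    origin. *)
Lemma lift_plane_map_int (R : realType) (a b c d : R) (f : torus R -> torus R) :
  is_lift (plane_map a b c d) f ->
  [/\ a \is a Num.int, b \is a Num.int, c \is a Num.int & d \is a Num.int].
Proof.
move=> Ff.
have col z : lattice_rel z (0, 0) ->
    lattice_rel (plane_map a b c d z) (plane_map a b c d (0, 0)).
  by move=> /torus_piP z0; apply/torus_piP; rewrite !Ff z0.
have e1 : lattice_rel (1, 0) ((0, 0) : R * R).
  by rewrite /lattice_rel /= !subr0 rpred0 rpred1.
have e2 : lattice_rel (0, 1) ((0, 0) : R * R).
  by rewrite /lattice_rel /= !subr0 rpred0 rpred1.
move: (col _ e1) (col _ e2).
by rewrite /lattice_rel /= !(mulr0, mulr1, add0r, addr0, subr0)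
  => /andP[? ?] /andP[? ?].
Qed.

(** * Admissible velocities and triples *)

Lemma lorentzE (R : realType) (V c : R) :
  let s := Num.sqrt (1 - V ^+ 2 / c ^+ 2) in
  lorentz V c = plane_map s^-1 (- (V / s)) (- (V / c ^+ 2 / s)) s^-1.
Proof.
move=> s; apply/funext => z; rewrite /lorentz /plane_map -/s.
by congr pair; ring.
Qed.

Lemma is_tripleE (m n p : nat) :
  is_triple (m, n, p) <-> [/\ (1 <= n)%N, (1 <= p)%N & m ^ 2 = (n * p).+1]%N.
Proof.
split; first by move=> [m2 n1 p1 e]; split => //; lia.
by move=> [n1 p1 e]; split => //; [nia|lia].
Qed.

Lemma pell_solutionE (d m r : nat) :
  pell_solution d m r <-> [/\ (1 <= m)%N, (1 <= r)%N & m ^ 2 = (d * r ^ 2).+1]%N.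
Proof. by split=> -[m1 r1 e]; split => //; lia. Qed.

(** Here 1 - V^2/c^2 = 1 - n p/m^2 = 1/m^2, so the Lorentz factor is m. *)
Lemma lorentz_triple (R : realType) (m n p : nat) :
  is_triple (m, n, p) ->
  lorentz (n%:R / m%:R) (Num.sqrt (n%:R / p%:R)) =
  plane_map m%:R (- n%:R) (- p%:R) m%:R :> (R * R -> R * R).
Proof.
move=> /is_tripleE[n1 p1 e].
have m1 : (0 < m)%N by rewrite -(ltn_exp2r 0 m (isT : 0 < 2)%N) e.
have eR : (m%:R : R) ^+ 2 = n%:R * p%:R + 1.
  by rewrite -natrX e -natr1 natrM.
have m0 : (m%:R : R) != 0 by rewrite pnatr_eq0 -lt0n.
have n0 : (n%:R : R) != 0 by rewrite pnatr_eq0 -lt0n.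
have p0 : (p%:R : R) != 0 by rewrite pnatr_eq0 -lt0n.
have c2 : Num.sqrt (n%:R / p%:R : R) ^+ 2 = n%:R / p%:R.
  by rewrite sqr_sqrtr// divr_ge0.
rewrite lorentzE c2.
have -> : Num.sqrt (1 - (n%:R / m%:R) ^+ 2 / (n%:R / p%:R)) = (m%:R : R)^-1.
  rewrite -[RHS]ger0_norm ?invr_ge0// -sqrtr_sqr; congr Num.sqrt.
  have -> : 1 - (n%:R / m%:R) ^+ 2 / (n%:R / p%:R : R)
    = (m%:R ^+ 2 - n%:R * p%:R) * (m%:R^-1) ^+ 2.
    by field; rewrite m0 n0 p0.
  by rewrite eR; ring.
by rewrite invrK; congr plane_map; field; rewrite ?m0 ?n0 ?p0.
Qed.

(** The inequality V < c amounts to n p < m^2, and the matrix of the Lorentz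
    map is integral of determinant m^2 - n p = 1. *)
Lemma triple_admissible (R : realType) (V c : R) (t : nat * nat * nat) :
  corresponds V c t -> admissible_pair V c /\ 0 < V.
Proof.
move: t => [[m n] p] [tr -> ->].
have /is_tripleE[n1 p1 e] := tr.
have m1 : (0 < m)%N by rewrite -(ltn_exp2r 0 m (isT : 0 < 2)%N) e.
have V0 : 0 < n%:R / m%:R :> R by rewrite divr_gt0 ?ltr0n.
split=> //; split.
  rewrite gtr0_norm// V0 /= -[ltLHS]ger0_norm ?ltW// -sqrtr_sqr.
  rewrite ltr_sqrt ?divr_gt0 ?ltr0n//.
  rewrite expr_div_n ltr_pdivrMr ?exprn_gt0 ?ltr0n// mulrAC.
  rewrite ltr_pdivlMr ?ltr0n// -!natrX -!natrM ltr_nat e; nia.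
exists (@torus_map R m%:R (- n%:R) (- p%:R) m%:R); split.
  apply: torus_map_homeomorphism; rewrite ?rpredN ?natr_int//.
  by rewrite mulrNN -!natrM mulnn e -natr1 addrAC subrr add0r.
by rewrite lorentz_triple//; apply: torus_map_lift; rewrite ?rpredN ?natr_int.
Qed.

(** The matrix entries 1/s, V/s and V/(c^2 s) are positive integers m, n, p,
    and m^2 = n p + 1 is the definition of s. *)
Lemma admissible_triple (R : realType) (V c : R) :
  admissible_pair V c -> 0 < V -> exists t, corresponds V c t.
Proof.
move=> [/andP[_ Vc] [f [_ lif]]] V0; rewrite gtr0_norm// in Vc.
have c0 : 0 < c := lt_trans V0 Vc.
have g0 : 0 < 1 - V ^+ 2 / c ^+ 2.
  by rewrite subr_gt0 ltr_pdivrMr ?exprn_gt0// mul1r ltrXn2r// ltW.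
rewrite lorentzE in lif; move: lif.
set s := Num.sqrt _ => /lift_plane_map_int[im iN ip _].
have s0 : 0 < s by rewrite sqrtr_gt0.
rewrite !rpredN in iN ip.
have s2 : s ^+ 2 = 1 - V ^+ 2 / c ^+ 2 by rewrite sqr_sqrtr// ltW.
have Vs : 0 < V / s by rewrite divr_gt0.
have Vcs : 0 < V / c ^+ 2 / s by rewrite !divr_gt0// exprn_gt0.
have sV : 0 < s^-1 by rewrite invr_gt0.
move: im iN ip; rewrite !intrEge0 ?ltW// => /natrP[m em] /natrP[n en] /natrP[p ep].
exists (m, n, p).
have m0 : m%:R != 0 :> R by rewrite -em gt_eqF.
have n0 : n%:R != 0 :> R by rewrite -en gt_eqF.
have p0 : p%:R != 0 :> R by rewrite -ep gt_eqF.
split.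
- apply/is_tripleE; split; rewrite ?lt0n -?(pnatr_eq0 R)//.
  apply/eqP; rewrite -(eqr_nat R) -natr1 natrX natrM -em -en -ep; apply/eqP.
  have -> : V / s * (V / c ^+ 2 / s) + 1 = (V ^+ 2 / c ^+ 2 + s ^+ 2) / s ^+ 2.
    by field; rewrite !gt_eqF.
  by rewrite s2 addrCA subrr addr0 mul1r -s2 exprVn.
- rewrite -en -ep -[LHS]gtr0_norm// -sqrtr_sqr; congr Num.sqrt.
  by field; rewrite !gt_eqF.
- by rewrite -en -em; field; rewrite gt_eqF.
Qed.

(** Substitute n p = m^2 - 1 in V^2 = (n/p) (n p/m^2). *)
Lemma corresponds_sqr (R : realType) (V c : R) (m n p : nat) :
  corresponds V c (m, n, p) -> V ^+ 2 = c ^+ 2 * (1 - (m%:R ^+ 2)^-1).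
Proof.
move=> [/is_tripleE[n1 p1 e] -> ->].
have m1 : (0 < m)%N by rewrite -(ltn_exp2r 0 m (isT : 0 < 2)%N) e.
have eR : (n%:R * p%:R : R) = m%:R ^+ 2 - 1.
  by rewrite -natrX e -natr1 natrM addrK.
have m0 : (m%:R : R) != 0 by rewrite pnatr_eq0 -lt0n.
have p0 : (p%:R : R) != 0 by rewrite pnatr_eq0 -lt0n.
rewrite sqr_sqrtr ?divr_ge0//.
have -> : (n%:R / m%:R) ^+ 2 = n%:R / p%:R * (n%:R * p%:R / m%:R ^+ 2) :> R.
  by field; rewrite m0 p0.
by rewrite eR; field; rewrite m0 p0.
Qed.

Lemma corresponds_le (R : realType) (V V' c : R) (m n p m' n' p' : nat) :
  corresponds V c (m, n, p) -> corresponds V' c (m', n', p') ->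
  (m <= m')%N -> V <= V'.
Proof.
move=> cV cV' mm'.
have [_ V0] := triple_admissible cV; have [_ V'0] := triple_admissible cV'.
have [[m2 _ _ _] _ _] := cV.
rewrite -(@ler_pXn2r _ 2) ?nnegrE ?(ltW V0) ?(ltW V'0)//.
rewrite (corresponds_sqr cV) (corresponds_sqr cV').
rewrite ler_wpM2l ?sqr_ge0// lerD2l lerN2 lef_pV2 ?posrE ?exprn_gt0 ?ltr0n//.
- by rewrite lerXn2r ?nnegrE// ler_nat.
- exact: leq_trans (ltnW m2) mm'.
- exact: ltnW.
Qed.

(** * Triples of a given c and the Pell equation *)

Lemma proportional_coprime (n p ns ps : nat) :
  (0 < ps)%N -> coprime ns ps -> (n * ps = ns * p)%N ->
  exists k, n = (k * ns)%N /\ p = (k * ps)%N.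
Proof.
move=> ps0 cop e.
have /dvdnP[k pk] : (ps %| p)%N.
  have pn : coprime ps ns by rewrite coprime_sym.
  by rewrite -(Gauss_dvdr p pn) -e dvdn_mull.
exists k; split=> //; apply/eqP; rewrite -(eqn_pmul2r ps0) e pk; apply/eqP.
by rewrite mulnCA mulnA mulnAC.
Qed.

(** Writing (n, p) = (k ns, k ps), the equation m^2 - n p = 1 reads
    m^2 - (ns ps) k^2 = 1. *)
Lemma triple_of_pell (R : realType) (c : R) (ns ps m n p : nat) :
  0 < c -> (0 < ns)%N -> (0 < ps)%N -> coprime ns ps ->
  c ^+ 2 = ns%:R / ps%:R ->
  triple_of c (m, n, p) <->
  exists k, [/\ n = (k * ns)%N, p = (k * ps)%N & pell_solution (ns * ps) m k].
Proof.
move=> c0 ns0 ps0 cop c2; split.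
  move=> [/is_tripleE[n1 p1 e] ec].
  have [k [nk pk]] : exists k, n = (k * ns)%N /\ p = (k * ps)%N.
    apply: proportional_coprime => //; apply/eqP; rewrite -(eqr_nat R) !natrM.
    rewrite -eqr_div ?pnatr_eq0 -?lt0n// -c2 -ec.
    by rewrite sqr_sqrtr// divr_ge0.
  exists k; split=> //; apply/pell_solutionE; move: n1 p1 e; rewrite nk pk => *.
  by split; [nia|nia|lia].
move=> [k [-> -> /pell_solutionE[m1 k1 e]]]; split.
  by apply/is_tripleE; split; [nia|nia|lia].
rewrite -[RHS]gtr0_norm// -sqrtr_sqr c2 !natrM -mulf_div divff ?mul1r//.
by rewrite pnatr_eq0 -lt0n.
Qed.

Theorem mainTheorem3 (R : realType) (c : R) (ns ps d m0 r0 : nat)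
    (c_adm : admissible c)
    (ns_gt0 : (0 < ns)%N) (ps_gt0 : (0 < ps)%N) (ns_ps : coprime ns ps)
    (c2E : c ^+ 2 = ns%:R / ps%:R)
    (dE : d%:R = c ^+ 2 * ps%:R ^+ 2 :> R)
    (pell0 : minimal_pell_solution d m0 r0) :
  let m1 := m0 in
  let n1 := (r0 * ns)%N in
  let p1 := (r0 * ps)%N in
  let V1 : R := n1%:R / m1%:R in
  [/\ minimal_triple c (m1, n1, p1),
      corresponds V1 c (m1, n1, p1)
    & is_minimum (positive_spectrum c) V1].
Proof.
move=> m1 n1 p1 V1.
have c0 : 0 < c by case: c_adm.
have dnp : d = (ns * ps)%N.
  apply/eqP; rewrite -(eqr_nat R) dE c2E natrM expr2 mulrA divfK//.
  by rewrite pnatr_eq0 -lt0n.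
have tripleP m n p := triple_of_pell m n p c0 ns_gt0 ps_gt0 ns_ps c2E.
have [pell1 pell_le] := pell0; rewrite dnp in pell1 pell_le.
have t1 : triple_of c (m1, n1, p1) by apply/tripleP; exists r0.
have cV1 : corresponds V1 c (m1, n1, p1) by case: t1.
split=> //.
  split=> // -[[m n] p] /tripleP[k [-> -> pellk]] neq.
  have [mm rk] := pell_le _ _ pellk.
  have /pell_solutionE[_ r1 e0] := pell1.
  have /pell_solutionE[_ _ e] := pellk.
  (* A solution of the Pell equation is determined by its second component
     and its first component increases with the second, so a solution other
     than the minimal one is strictly above it in both. *)
  have lt_rk : (r0 < k)%N.
    rewrite ltn_neqAle rk andbT; apply/eqP => rk'; apply: neq.
    congr (_, _, _); rewrite -?rk' //.
    by apply/eqP; rewrite -(eqn_exp2r _ _ (isT : 0 < 2)%N) e e0 rk'.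
  split; [|by rewrite ltn_pmul2r|by rewrite ltn_pmul2r].
  rewrite -(ltn_exp2r _ _ (isT : 0 < 2)%N) e e0 ltnS.
  rewrite ltn_pmul2l ?muln_gt0 ?ns_gt0//.
  by rewrite ltn_exp2r.
split; first exact: triple_admissible cV1.
move=> V [admV V0]; have [[[m n] p] cV] := admissible_triple admV V0.
apply: (corresponds_le cV1 cV).
have /tripleP[k [_ _ pellk]] : triple_of c (m, n, p).
  by case: cV => tr -> _; split.
by have [] := pell_le _ _ pellk.
Qed.
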